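(* For all random variables $X$ and $Y$, $\bar h(X,Y)=\bar h(Y,X)$, where $\bar h(\cdot,\cdot)$ denotes joint ID-Entropy.
   Context: Standing assumptions. All random variables (RVs) take values in Euclidean spaces and satisfy (including concatenations): (A1) the support of the distribution of the RV is a finite union of locally Euclidean manifolds, where locally Euclidean means every point in the support has a local neighborhood homeomorphic to $\mathbb{R}^k$ for some non-negative integer $k$; (A2) for any subset of the RVs under consideration, the geodesic distance between any two connected points in the support of their joint distribution is finite; (A3) the support has countably many connected components. f-relations. For RVs $X,Y$, write $X\leadsto Y$ ($Y$ is f-related to $X$) if there is a continuous function $f$ with $f(X)=Y$. Write $X\leftrightarrow Y$ (symmetric f-relation) if $X\leadsto Y$ and $Y\leadsto X$. For several RVs, tuples are treated as concatenated RVs. ID-Entropy. Let $X\in\mathbb{R}^d$ have distribution $P$. For $\rho\in\mathbb{R}^d$ and $\epsilon>0$, let $X_\epsilon^\rho$ be an RV distributed as $P$ restricted to $\{x:\lVert x-\rho\rVert\le\epsilon\}$ and normalized to total mass 1. The $\epsilon$-neighborhood intrinsic dimension is $d_\epsilon(\rho)=\min\{n:\ (v_1,\dots,v_n)\leftrightarrow X_\epsilon^\rho\}$, where each $v_i$ is either a continuous RV with $0\le v_i\le 1$ or a binary RV with $v_i\in\{0,1\}$ (the joint distribution being an arbitrary dense one); i.e. the minimum total number of such continuous and/or binary RVs that can be associated with $X_\epsilon^\rho$ via a homeomorphism. Then $\bar h^\epsilon(X)=\mathbb{E}_{\rho\sim P}[d_\epsilon(\rho)]$ is the $\epsilon$-ID-Entropy,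 and $\bar h(X)=\lim_{\epsilon\to0^+}\bar h^\epsilon(X)$ is the ID-Entropy. Joint ID-Entropy: for $X\in\mathbb{R}^d$, $Y\in\mathbb{R}^l$, $\bar h(X,Y)=\bar h(V)$ where $V\in\mathbb{R}^{d+l}$ is the concatenation of $X$ and $Y$. *)

(* Defs.v *)
From HB Require Import structures.
From mathcomp Require Import all_boot all_order all_algebra.
From mathcomp Require Import all_classical all_reals all_analysis.

Set Implicit Arguments.
Unset Strict Implicit.
Unset Printing Implicit Defensive.

Import Order.TTheory GRing.Theory Num.Theory.
Import numFieldNormedType.Exports.

Local Open Scope classical_set_scope.
Local Open Scope ring_scope.

(* R^n with its Borel sigma-algebra. *)
Notation borel_rV R n := (g_sigma_algebraType (@open 'rV[R]_n)).

Section euclidean_space.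
Context {R : realType}.

(* The library norm on 'rV[R]_n is the sup norm; this is the Euclidean one. *)
Definition enorm n (x : 'rV[R]_n) : R := Num.sqrt (\sum_(i < n) x ord0 i ^+ 2).

Definition eball n (rho : 'rV[R]_n) (eps : R) : set 'rV[R]_n :=
  [set x | enorm (x - rho) <= eps].

Lemma closed_eball n (rho : 'rV[R]_n) eps : closed (eball rho eps).
Proof.
have cS : continuous (fun x : 'rV[R]_n => \sum_(i < n) (x - rho) ord0 i ^+ 2).
  apply: continuous_big => [|i _ x]; first exact: add_continuous.
  have -> : (fun x : 'rV[R]_n => (x - rho) ord0 i ^+ 2) =
      (fun x : 'rV[R]_n => (x ord0 i - rho ord0 i) * (x ord0 i - rho ord0 i)).
    by apply/funext => y; rewrite !mxE expr2.
  have c : (fun x : 'rV[R]_n => x ord0 i - rho ord0 i) @ x -->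
           x ord0 i - rho ord0 i.
    have k := @cvg_cst R (rho ord0 i) _ (nbhs x) (nbhs_filter x).
    apply: cvgB k.
    exact: (@coord_continuous R 1 n ord0 i x).
  exact: (cvgM c c).
have cN : continuous (fun x : 'rV[R]_n => enorm (x - rho) : R).
  move=> x; apply: (continuous_comp (cS x)); exact: sqrt_continuous.
have -> : eball rho eps =
    (fun x : 'rV[R]_n => enorm (x - rho)) @^-1` [set y | y <= eps] by [].
by apply: preimage_closed => [x _|]; [exact: cN|exact: closed_le].
Qed.

Lemma measurable_eball n (rho : 'rV[R]_n) eps :
  measurable (eball rho eps : set (borel_rV R n)).
Proof.
rewrite -[eball _ _]setCK; apply: measurableC.
apply: sub_sigma_algebra; exact/closed_openC/closed_eball.
Qed.

Lemma open_rV_bigcup n (U : set 'rV[R]_n) : open U ->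
  U = \bigcup_(f in [set f : {ffun 'I_n -> rat * rat} |
        [set x : 'rV[R]_n | forall i, ratr (f i).1 < x ord0 i < ratr (f i).2]
        `<=` U])
      [set x : 'rV[R]_n | forall i, ratr (f i).1 < x ord0 i < ratr (f i).2].
Proof.
move=> oU; apply/seteqP; split=> [x Ux|x [f /= fU]]; last exact: fU.
have [P xP PU] : nbhs x U by exact: open_nbhs_nbhs.
have /choice[f fP] i : exists q : rat * rat,
    ratr q.1 < x ord0 i < ratr q.2 /\
    (forall y : R, ratr q.1 < y < ratr q.2 -> P ord0 i y).
  have /nbhs_ballP[e /= e0 xe] := xP ord0 i.
  have [q1 /itvP h1] : exists q, ratr q \in `]x ord0 i - e, x ord0 i[.
    by apply: rat_in_itvoo; rewrite ltrBlDr ltrDl.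
  have [q2 /itvP h2] : exists q, ratr q \in `]x ord0 i, x ord0 i + e[.
    by apply: rat_in_itvoo; rewrite ltrDl.
  exists (q1, q2); split=> [|y /andP[y1 y2]] /=; first by rewrite h1 h2.
  apply: xe; rewrite /ball /= ltr_distlC.
  by rewrite (lt_trans _ y1) ?h1// (lt_trans y2) ?h2.
exists [ffun i => f i] => /= [y fy|i]; last by rewrite ffunE; exact: (fP i).1.
apply: PU => a i; rewrite (ord1 a).
by apply: (fP i).2; have := fy i; rewrite ffunE.
Qed.

End euclidean_space.

Section concatenation.
Context {R : realType} d {T : measurableType d}.

Lemma measurable_fun_rV n (Z : T -> borel_rV R n) :
  (forall (i : 'I_n) (U : set R), open U ->
    measurable [set w | U ((Z w : 'rV[R]_n) ord0 i)]) ->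
  measurable_fun setT Z.
Proof.
move=> mZ; apply: (@measurability _ _ T (borel_rV R n) setT Z (@open 'rV[R]_n) erefl).
move=> _ [U /open_rV_bigcup oU <-]; rewrite setTI oU preimage_bigcup.
rewrite bigcup_mkcond; apply: countable_bigcupT_measurable => // f.
case: ifPn => // _.
have -> : Z @^-1` [set x : 'rV[R]_n | forall i,
     ratr (f i).1 < x ord0 i < ratr (f i).2] =
  \bigcap_(i in [set: 'I_n])
     [set w | `]ratr (f i).1, ratr (f i).2[%classic ((Z w : 'rV[R]_n) ord0 i)].
  apply/seteqP; split=> [w Zw i _|w Zw i].
    by rewrite /= in_itv; exact: Zw.
  by have := Zw i Logic.I; rewrite /= in_itv.
apply: fin_bigcap_measurable => // i _; apply: mZ; exact: interval_open.
Qed.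

Definition concat m l (X : {mfun T >-> borel_rV R m})
    (Y : {mfun T >-> borel_rV R l}) : T -> borel_rV R (m + l) :=
  fun w => row_mx (X w : 'rV[R]_m) (Y w : 'rV[R]_l).

Lemma measurable_concat m l X Y : measurable_fun setT (@concat m l X Y).
Proof.
have coord n (Z : {mfun T >-> borel_rV R n}) (i : 'I_n) (U : set R) : open U ->
    measurable [set w | U ((Z w : 'rV[R]_n) ord0 i)].
  move=> oU.
  have mU : measurable ([set x : 'rV[R]_n | U (x ord0 i)] : set (borel_rV R n)).
    apply: sub_sigma_algebra.
    by move/continuousP : (@coord_continuous R 1 n ord0 i); exact.
  exact: (measurable_funPTI Z mU).
apply: measurable_fun_rV => i U oU; rewrite /concat.
case: (splitP i) => j ij.
- have -> : i = lshift l j by exact/val_inj.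
  by under eq_set do rewrite row_mxEl; exact: coord.
- have -> : i = rshift m j by exact/val_inj.
  by under eq_set do rewrite row_mxEr; exact: coord.
Qed.

HB.instance Definition _ m l X Y :=
  isMeasurableFun.Build _ _ _ _ (@concat m l X Y) (@measurable_concat m l X Y).

End concatenation.

Definition joint_rv {R : realType} d {T : measurableType d}
    {P : probability T R} m l (X : {RV P >-> borel_rV R m})
    (Y : {RV P >-> borel_rV R l}) : {RV P >-> borel_rV R (m + l)} :=
  (concat X Y : {mfun T >-> borel_rV R (m + l)}).

Section standing_assumptions.
Context {R : realType}.

Definition support n (mu : set (borel_rV R n) -> \bar R) : set 'rV[R]_n :=
  [set x | forall U : set 'rV[R]_n, open U -> U x -> (0 < mu U)%E].

Definition homeomorphic m n (A : set 'rV[R]_m) (B : set 'rV[R]_n) : Prop :=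
  exists (f : 'rV[R]_m -> 'rV[R]_n) (g : 'rV[R]_n -> 'rV[R]_m),
    [/\ {within A, continuous f}, {within B, continuous g},
        f @` A = B, g @` B = A &
        {in A, cancel f g} /\ {in B, cancel g f}].

(* Second countability and the Hausdorff property are inherited from R^n. *)
Definition locally_euclidean n (M : set 'rV[R]_n) : Prop :=
  forall x, M x -> exists (k : nat) (U : set 'rV[R]_n),
    [/\ open U, U x & homeomorphic (M `&` U) [set: 'rV[R]_k]].

(* Length of gamma : [0, 1] -> R^n; s lists the points of a subdivision
   0 < s_0 < ... < s_k = 1. *)
Definition curve_length n (gamma : R -> 'rV[R]_n) : \bar R :=
  ereal_sup [set (let F := gamma \o nth 1 (0 :: s) in
                  \sum_(0 <= i < size s) enorm (F i.+1 - F i))%:E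
            | s in itv_partition 0 1].

Definition geodesic_dist n (S : set 'rV[R]_n) (x y : 'rV[R]_n) : \bar R :=
  ereal_inf [set curve_length gamma | gamma in
    [set gamma : R -> 'rV[R]_n |
      [/\ {within `[0, 1], continuous gamma}, gamma @` `[0, 1] `<=` S,
          gamma 0 = x & gamma 1 = y]]].

Definition finite_union_of_manifolds n (S : set 'rV[R]_n) : Prop :=
  exists (N : nat) (M : 'I_N -> set 'rV[R]_n),
    (forall i, locally_euclidean (M i)) /\ S = \bigcup_i M i.

Definition finite_geodesics n (S : set 'rV[R]_n) : Prop :=
  forall x y, S x -> connected_component S x y ->
    (geodesic_dist S x y < +oo)%E.

Definition countably_many_components n (S : set 'rV[R]_n) : Prop :=
  countable (connected_component S @` S).

Definition regular d (T : measurableType d) (P : probability T R) n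
    (X : {RV P >-> borel_rV R n}) : Prop :=
  let S := support (distribution P X) in
  [/\ finite_union_of_manifolds S, finite_geodesics S &
      countably_many_components S].

End standing_assumptions.

Section id_entropy.
Context {R : realType}.

(* f is continuous on all of R^m: as the support of X is closed, Tietze's
   theorem makes this the same as continuity on the support. *)
Definition f_related d (T : measurableType d) (P : probability T R) m n
    (X : {RV P >-> borel_rV R m}) (Y : {RV P >-> borel_rV R n}) : Prop :=
  exists f : 'rV[R]_m -> 'rV[R]_n,
    continuous f /\ {ae P, forall w, f (X w) = Y w}.

Definition sym_f_related d (T : measurableType d) (P : probability T R) m n
    (X : {RV P >-> borel_rV R m}) (Y : {RV P >-> borel_rV R n}) : Prop :=
  f_related X Y /\ f_related Y X.

(* mu conditioned on the closed Euclidean ball; the Dirac mass is only used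
   when the ball is mu-null, which does not happen for rho in the support. *)
Definition local_law n (mu : probability (borel_rV R n) R) (rho : 'rV[R]_n)
    (eps : R) : probability (borel_rV R n) R :=
  mnormalize (mrestr mu (measurable_eball rho eps))
             (dirac (rho : borel_rV R n)).

(* The product of {0, 1} over the coordinates flagged by b and of [0, 1] over
   the others. *)
Definition code_range n (b : 'I_n -> bool) : set 'rV[R]_n :=
  [set x | forall i, if b i then x ord0 i = 0 \/ x ord0 i = 1
                     else 0 <= x ord0 i <= 1].

(* v = (v_1, ..., v_n) has coordinates that are binary (b i) or continuous,
   i.e. atomless with values in [0, 1], and its joint law is dense: it charges
   every open set meeting the product of the ranges. *)
Definition is_code d (T : measurableType d) (P : probability T R) n
    (v : {RV P >-> borel_rV R n}) : Prop :=
  exists b : 'I_n -> bool,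
    [/\ {ae P, forall w, code_range b (v w)},
        (forall i, ~~ b i -> forall t : R,
           P [set w | (v w : 'rV[R]_n) ord0 i = t] = 0%E) &
        code_range b `<=` support (distribution P v)].

Definition identity n : borel_rV R n -> borel_rV R n := fun x => x.

Lemma measurable_identity n : measurable_fun setT (@identity n).
Proof. exact: measurable_id. Qed.

HB.instance Definition _ n :=
  isMeasurableFun.Build _ _ _ _ (@identity n) (@measurable_identity n).

(* A random vector with law [local_law mu rho eps]: the identity on R^n
   equipped with that law. *)
Definition local_rv n (mu : probability (borel_rV R n) R) (rho : 'rV[R]_n)
    (eps : R) : {RV (local_law mu rho eps) >-> borel_rV R n} :=
  (@identity n : {mfun borel_rV R n >-> borel_rV R n}).

(* Taking v on the probability space of [local_rv] loses no generality, since
   v has to be a.s. a function of it. The infimum is a minimum unless there is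
   no such v, in which case it is +oo. *)
Definition local_dim n (mu : probability (borel_rV R n) R) (eps : R)
    (rho : 'rV[R]_n) : \bar R :=
  ereal_inf [set k%:R%:E | k in [set k : nat |
    exists v : {RV (local_law mu rho eps) >-> borel_rV R k},
      is_code v /\ sym_f_related v (local_rv mu rho eps)]].

(* For a non-negative integrand that is not measurable, the library integral is
   the supremum over the simple functions below it. *)
Definition eps_id_entropy d (T : measurableType d) (P : probability T R) n
    (X : {RV P >-> borel_rV R n}) (eps : R) : \bar R :=
  (\int[distribution P X]_rho local_dim (distribution P X) eps rho)%E.

(* [lim] has a junk value when the limit does not exist. *)
Definition id_entropy d (T : measurableType d) (P : probability T R) n
    (X : {RV P >-> borel_rV R n}) : \bar R :=
  lim (eps_id_entropy X eps @[eps --> 0^'+]).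

Definition joint_id_entropy d (T : measurableType d) (P : probability T R) m l
    (X : {RV P >-> borel_rV R m}) (Y : {RV P >-> borel_rV R l}) : \bar R :=
  id_entropy (joint_rv X Y).

End id_entropy.

(* Main.v *)
(* Exchanging the two blocks of coordinates is a bijective linear isometry
   carrying the law of (Y, X) to that of (X, Y). It maps balls to balls, hence
   local laws to local laws, and codes are transported along its inverse; so the
   local dimensions correspond, and the epsilon-entropies agree for every
   epsilon. Since local_dim is not known to be measurable, the change of
   variables is done on the simple functions defining the integral; the image
   laws agree even on non-measurable sets, as pushforwards are defined on all
   sets. *)
Require Import Defs.
From mathcomp Require Import all_boot all_order all_algebra.
From mathcomp Require Import all_classical all_reals all_analysis.
From HB Require Import structures.

Set Implicit Arguments.
Unset Strict Implicit.
Unset Printing Implicit Defensive.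

Import Order.TTheory GRing.Theory Num.Theory.
Import numFieldNormedType.Exports.
Import HBNNSimple.

Local Open Scope classical_set_scope.
Local Open Scope ring_scope.

Lemma nnsfun_comp {R : realType} {d1 d2} {T1 : measurableType d1}
    {T2 : measurableType d2} (s : T1 -> T2) (h : {nnsfun T2 >-> R}) :
  measurable_fun setT s -> exists g : {nnsfun T1 >-> R}, g = h \o s :> (_ -> _).
Proof.
move=> ms.
have mg : measurable_fun setT (h \o s) by exact: measurableT_comp.
have fg : finite_set (range (h \o s)).
  by apply: sub_finite_set (fimfunP h) => _ [x _ <-]; exists (s x).
have g0 x : 0 <= (h \o s) x by exact: fun_ge0.
pose m1 := isMeasurableFun.Build _ _ _ _ (h \o s) mg.
pose m2 := FiniteImage.Build _ _ (h \o s) fg.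
pose m3 := isNonNegFun.Build _ _ (h \o s) g0.
by exists (HB.pack_for {nnsfun T1 >-> R} (h \o s) m1 m2 m3).
Qed.

(* Simple functions are pulled back along s, so f and g need not be measurable. *)
Lemma ge0_integral_image_law_le {R : realType} {d1 d2} {T1 : measurableType d1}
    {T2 : measurableType d2} (mu : {measure set T1 -> \bar R})
    (nu : {measure set T2 -> \bar R}) (s : T1 -> T2)
    (f : T2 -> \bar R) (g : T1 -> \bar R) :
  measurable_fun setT s -> (forall A, nu A = mu (s @^-1` A)) ->
  (forall y, 0 <= f y)%E -> (forall x, f (s x) <= g x)%E ->
  (\int[nu]_y f y <= \int[mu]_x g x)%E.
Proof.
move=> ms numu f0 fg.
have g0 x : (0 <= g x)%E by exact: le_trans (f0 _) (fg x).
rewrite !ge0_integralTE//.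
apply: le_ereal_sup => _ [h /= hf <-].
have [k kE] := nnsfun_comp h ms.
exists k; first by move=> x; rewrite kE; exact: le_trans (hf _) (fg x).
(* Each value [r] is weighted by the measure of its fibre, and the fibre of [h \o s] is the preimage
   under [s] of that of [h]. *)
by apply: eq_fsbigr => r _; rewrite kE numu.
Qed.

Lemma continuous_measurable_rV {R : realType} a b (s : 'rV[R]_a -> 'rV[R]_b) :
  continuous s -> measurable_fun setT (s : borel_rV R a -> borel_rV R b).
Proof.
move=> cs.
apply: (@measurability _ _ (borel_rV R a) (borel_rV R b) setT s
  (@open 'rV[R]_b) erefl) => _ [U oU <-].
rewrite setTI; apply: sub_sigma_algebra.
by move/continuousP : cs; exact.
Qed.

(** The total masses agree because the preimage of the whole space is the whole space, so both sides
    take the same branch: rescaling, or the default laws [Q] and [P]. *)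
Lemma mnormalize_image {R : realType} {d1 d2} {T1 : measurableType d1}
    {T2 : measurableType d2} (mu : {measure set T1 -> \bar R})
    (nu : {measure set T2 -> \bar R}) (P : probability T1 R)
    (Q : probability T2 R) (s : T1 -> T2) :
  (forall A, nu A = mu (s @^-1` A)) -> (forall A, Q A = P (s @^-1` A)) ->
  forall A, mnormalize nu Q A = mnormalize mu P (s @^-1` A).
Proof.
move=> numu QP A; rewrite /mnormalize numu preimage_setT.
by case: ifP => _; rewrite ?QP ?numu.
Qed.

Section image_under_isometry.
Context {R : realType} (a b : nat).
Variables (s : 'rV[R]_a -> 'rV[R]_b) (t : 'rV[R]_b -> 'rV[R]_a).
Hypotheses (st : cancel s t) (ts : cancel t s).
Hypotheses (cs : continuous s) (ct : continuous t).
Hypothesis sE : forall x y, enorm (s x - s y) = enorm (x - y).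
Variables (mu : probability (borel_rV R a) R) (nu : probability (borel_rV R b) R).
Hypothesis numu : forall A : set 'rV[R]_b, nu A = mu (s @^-1` A).

Lemma local_law_image rho eps (A : set 'rV[R]_b) :
  local_law nu (s rho) eps A = local_law mu rho eps (s @^-1` A).
Proof.
have ballE : s @^-1` eball (s rho) eps = eball rho eps.
  by apply/seteqP; split=> x; rewrite /eball /= sE.
apply: mnormalize_image => // B.
by rewrite /= /mrestr -ballE; exact: numu.
Qed.

(** A code [v] near [rho] yields the code [v \o t] of the same length near [s rho], so the infimum
    on the left runs over at least as many lengths. *)
Lemma local_dim_image_le eps rho :
  (local_dim nu eps (s rho) <= local_dim mu eps rho)%E.
Proof.
apply: le_ereal_inf => _ [k [v [vcode [[f [cf fv]] [g [cg gv]]]]] <-].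
exists k => //.
have mt := continuous_measurable_rV ct.
have mw : measurable_fun setT (v \o t : borel_rV R b -> borel_rV R k).
  by apply: measurableT_comp => //; exact: measurable_funP.
(* As [t] undoes [s], it carries the local law at [s rho] back to the one at [rho]; hence [v \o t]
   has the law of [v]. *)
have lawE (A : set 'rV[R]_a) :
    local_law nu (s rho) eps (t @^-1` A) = local_law mu rho eps A.
  rewrite local_law_image; congr (local_law mu rho eps _).
  by apply/seteqP; split=> x; rewrite /= st.
have aeE (Q : 'rV[R]_a -> Prop) (Q' : 'rV[R]_b -> Prop) :
    (forall y, Q (t y) -> Q' y) -> {ae local_law mu rho eps, forall x, Q x} ->
    {ae local_law nu (s rho) eps, forall y, Q' y}.
  move=> QQ' [N [mN N0 QN]]; exists (t @^-1` N); split.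
  - by rewrite -[X in measurable X]setTI; exact: mt.
  - by rewrite lawE.
  - by move=> y /= Q'y; apply: QN => /= /QQ'.
pose w : {RV (local_law nu (s rho) eps) >-> borel_rV R k} :=
  HB.pack_for {mfun borel_rV R b >-> borel_rV R k} (v \o t)
    (isMeasurableFun.Build _ _ _ _ _ mw).
exists w; split.
  have [c [vc v0 cv]] := vcode; exists c; split.
  - exact: aeE _ vc.
  - move=> i ci r; rewrite -[RHS](v0 i ci r) -lawE; congr (local_law _ _ _ _).
  - move=> x /cv vx U oU Ux; have := vx U oU Ux.
    by rewrite /distribution /pushforward -lawE.
split.
(* If [f] recovers [x] from [v x], then [s \o f] recovers [s (t y) = y] from [v (t y)]. *)
- exists (s \o f); split.
    by move=> x; apply: continuous_comp; [exact: cf|exact: cs].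
  by apply: aeE fv => y /= fvE; rewrite fvE /=; exact: ts.
- exists (g \o t); split.
    by move=> x; apply: continuous_comp; [exact: ct|exact: cg].
  exact: aeE _ gv.
Qed.

End image_under_isometry.

Lemma local_dim_ge0 {R : realType} n (mu : probability (borel_rV R n) R) eps rho :
  (0 <= local_dim mu eps rho)%E.
Proof. by apply: le_ereal_inf_tmp => _ [k _ <-]; rewrite lee_fin. Qed.

Section swap.
Context {R : realType}.

Definition swap m l (x : 'rV[R]_(m + l)) : 'rV[R]_(l + m) :=
  row_mx (rsubmx x) (lsubmx x).

Lemma swapK m l : cancel (@swap m l) (@swap l m).
Proof. by move=> x; rewrite /swap row_mxKr row_mxKl hsubmxK. Qed.

Lemma enorm_swap m l (x : 'rV[R]_(m + l)) : enorm (swap x) = enorm x.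
Proof.
rewrite /enorm !big_split_ord/= addrC; congr (Num.sqrt (_ + _));
  by apply: eq_bigr => i _; rewrite ?row_mxEl ?row_mxEr mxE.
Qed.

Lemma swapB m l (x y : 'rV[R]_(m + l)) : swap x - swap y = swap (x - y).
Proof. by rewrite /swap opp_row_mx add_row_mx !linearB. Qed.

(** Every coordinate of [swap x] is a fixed coordinate of [x], and a neighbourhood of a row vector
    contains a finite intersection of coordinatewise conditions. *)
Lemma continuous_swap m l : continuous (@swap m l).
Proof.
move=> x U [P xP PU].
suff : \forall y \near x, forall i, P ord0 i (swap y ord0 i).
  by apply: filterS => y yP; apply: PU => i j; rewrite (ord1 i).
apply: (@filter_forall _ _ (fun i (y : 'rV[R]_(m + l)) => P ord0 i (swap y ord0 i)) _
  (nbhs_filter x)) => i; have := xP ord0 i.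
have [j E] : exists j, forall y, @swap m l y ord0 i = y ord0 j.
  rewrite /swap; case: (splitP i) => k ik.
  - exists (rshift m k) => y; have -> : i = lshift m k by exact/val_inj.
    by rewrite row_mxEl mxE.
  - exists (lshift l k) => y; have -> : i = rshift l k by exact/val_inj.
    by rewrite row_mxEr mxE.
rewrite E => xPj.
have /funext EP y : P ord0 i (swap y ord0 i) = P ord0 i (y ord0 j) by rewrite E.
by rewrite /prop_near1 EP; exact: (@coord_continuous R 1 _ ord0 j x _ xPj).
Qed.

End swap.

(** One inequality for arbitrary [X] and [Y] suffices: exchanging their roles gives the converse. *)
Lemma eps_id_entropy_swap_le {R : realType} {d} {T : measurableType d}
    {P : probability T R} {m l} (X : {RV P >-> borel_rV R m})
    (Y : {RV P >-> borel_rV R l}) eps :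
  (eps_id_entropy (joint_rv X Y) eps <= eps_id_entropy (joint_rv Y X) eps)%E.
Proof.
have swap_isom a b (x y : 'rV[R]_(a + b)) : enorm (swap x - swap y) = enorm (x - y).
  by rewrite swapB enorm_swap.
(* Both sides are the probability of one and the same event in [T], whether or not [A] is
   measurable. *)
have jointE (A : set 'rV[R]_(m + l)) : distribution P (joint_rv X Y) A =
    distribution P (joint_rv Y X) (@swap R l m @^-1` A).
  rewrite /distribution /pushforward; congr (P _).
  by apply/funext => w /=; rewrite /concat /swap row_mxKr row_mxKl.
apply: ge0_integral_image_law_le.
- exact: continuous_measurable_rV (@continuous_swap R l m).
- exact: jointE.
- exact: local_dim_ge0.
- move=> x; apply: (local_dim_image_le (@swapK R l m) (@swapK R m l)) => //;
    exact: continuous_swap.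
Qed.

Theorem mainTheorem7 (R : realType) (d : measure_display)
    (T : measurableType d) (P : probability T R) (m l : nat)
    (X : {RV P >-> borel_rV R m}) (Y : {RV P >-> borel_rV R l})
    (hX : regular X) (hY : regular Y) (hXY : regular (joint_rv X Y)) :
  joint_id_entropy X Y = joint_id_entropy Y X.
Proof.
(* Equality is proved between functions of [eps], so [lim] is applied to the same function on both
   sides and no convergence argument enters. *)
have epsE : eps_id_entropy (joint_rv X Y) = eps_id_entropy (joint_rv Y X).
  by apply/funext => eps; apply/eqP; rewrite eq_le !eps_id_entropy_swap_le.
by rewrite /joint_id_entropy /id_entropy epsE.
Qed.
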